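(* Let $A$ be a unital $C^*$-algebra and let $\mathcal{H}$ be a finitely or countably generated Hilbert $A$-module. If $K\in L(\mathcal{H})$, then there exists an atomic system for $K$, that is, there exist a finite or countable index set $J\subseteq\mathbb{N}$ and a sequence $\{f_n\}_{n\in J}$ in $\mathcal{H}$ which is an atomic system for $K$.
   Context: Hilbert $A$-modules are left $A$-modules with an $A$-valued inner product $\langle\cdot,\cdot\rangle$ that is $A$-linear in the first variable and satisfies $\langle x,y\rangle=\langle y,x\rangle^*$; the norm is $\|x\|=\|\langle x,x\rangle\|^{1/2}$, and the module is complete in it. $\mathcal{H}$ is countably generated if there is a countable set in $\mathcal{H}$ whose linear span (over $\mathbb{C}$ and $A$) is norm-dense in $\mathcal{H}$. $L(\mathcal{H})$ is the set of adjointable maps $\mathcal{H}\to\mathcal{H}$, i.e. maps $T$ for which there is $T^*:\mathcal{H}\to\mathcal{H}$ with $\langle Tx,y\rangle=\langle x,T^*y\rangle$ for all $x,y$. For a finite or countable index set $J\subseteq\mathbb{N}$, $\ell^2(A)=\{\{a_j\}_{j\in J}: a_j\in A,\ \sum_{j} a_ja_j^*\text{ converges in norm}\}$, a Hilbert $A$-module with pointwise operations and inner product $\langle\{a_j\},\{b_j\}\rangle=\sum_{j\in J}a_jb_j^*$. A sequence $\{f_n\}_{n\in J}$ of $\mathcal{H}$ is called an atomic system for $K\in L(\mathcal{H})$ if: (i) the series $\sum_{n\in J}c_nf_n$ converges (in norm) for all $\{c_n\}_{n\in J}\in\ell^2(A)$; (ii) there exists $C>0$ such that for every $x\in\mathcal{H}$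 there exists $\{a_{n,x}\}_{n\in J}\in\ell^2(A)$ such that $\sum_{n\in J}a_{n,x}a_{n,x}^*\leqslant C\langle x,x\rangle$ and $Kx=\sum_{n\in J}a_{n,x}f_n$. *)

(* Defs.v *)
From HB Require Import structures.
From mathcomp Require Import all_boot all_order all_algebra.
From mathcomp Require Import all_classical all_reals all_analysis.
From mathcomp Require Import complex.

Set Implicit Arguments.
Unset Strict Implicit.
Unset Printing Implicit Defensive.

Import Order.TTheory GRing.Theory Num.Theory.
Import numFieldNormedType.Exports.

Local Open Scope classical_set_scope.
Local Open Scope ring_scope.

(* The product is part of this structure, and not of an algType, for two       *)
(* reasons: in the library a type that is both a ring and a normed space is a  *)
(* numDomainType, normed over itself; and algType would exclude the zero       *)
(* algebra.                                                                    *)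
HB.mixin Record isUnitalCstarAlgebra (R : realType) A
    & CompleteNormedModule (R[i])%C A := {
  cmul : A -> A -> A ;
  cone : A ;
  cmulA : associative cmul ;
  cmul1l : left_id cone cmul ;
  cmul1r : right_id cone cmul ;
  cmulDl : left_distributive cmul +%R ;
  cmulDr : right_distributive cmul +%R ;
  cmulZl : forall (k : (R[i])%C) (a b : A), cmul (k *: a) b = k *: cmul a b ;
  cmulZr : forall (k : (R[i])%C) (a b : A), cmul a (k *: b) = k *: cmul a b ;
  cnormM : forall a b : A, `|cmul a b| <= `|a| * `|b| ;
  star : A -> A ;
  starD : forall a b : A, star (a + b) = star a + star b ;
  starZ : forall (k : (R[i])%C) (a : A), star (k *: a) = k^* *: star a ;
  starM : forall a b : A, star (cmul a b) = cmul (star b) (star a) ;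
  starK : involutive star ;
  cstar_identity : forall a : A, `|cmul (star a) a| = `|a| ^+ 2
}.

#[short(type="unitalCstarAlgType")]
HB.structure Definition UnitalCstarAlgebra (R : realType) :=
  {A of isUnitalCstarAlgebra R A & CompleteNormedModule (R[i])%C A}.

Infix "**" := cmul (at level 40, left associativity) : ring_scope.

Section CstarOrder.
Context {R : realType} {A : unitalCstarAlgType R}.

Definition invertible (a : A) : Prop := exists b : A, a ** b = cone /\ b ** a = cone.

Definition spectrum (a : A) : set (R[i])%C :=
  [set z | ~ invertible (z *: cone - a)].

(* In R[i], [0 <= z] holds exactly when z is a nonnegative real.               *)
Definition cstar_pos (a : A) : Prop :=
  star a = a /\ (forall z, spectrum a z -> 0 <= z).

Definition cstar_le (a b : A) : Prop := cstar_pos (b - a).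

End CstarOrder.

(* The action of A is a separate operation [act], since H is already an        *)
(* lmodType over the complex numbers. Definiteness of the inner product is     *)
(* contained in [hilbert_norm], the norm of H being definite.                  *)
HB.mixin Record isHilbertModule (R : realType) (A : unitalCstarAlgType R) H
    & CompleteNormedModule (R[i])%C H := {
  act : A -> H -> H ;
  actDl : forall (a b : A) (x : H), act (a + b) x = act a x + act b x ;
  actDr : forall (a : A) (x y : H), act a (x + y) = act a x + act a y ;
  actA : forall (a b : A) (x : H), act (a ** b) x = act a (act b x) ;
  act1 : forall x : H, act cone x = x ;
  actZ : forall (k : (R[i])%C) (a : A) (x : H), act (k *: a) x = k *: act a x ;
  inner : H -> H -> A ;
  innerD : forall x y z : H, inner (x + y) z = inner x z + inner y z ;
  innerZ : forall (a : A) (x y : H), inner (act a x) y = a ** inner x y ;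
  inner_star : forall x y : H, inner x y = star (inner y x) ;
  inner_pos : forall x : H, cstar_pos (inner x x) ;
  hilbert_norm : forall x : H, `|x| = sqrtC `|inner x x|
}.

#[short(type="hilbertModType")]
HB.structure Definition HilbertModule (R : realType)
    (A : unitalCstarAlgType R) :=
  {H of isHilbertModule R A H & CompleteNormedModule (R[i])%C H}.

Section HilbertModuleTheory.
Context {R : realType} {A : unitalCstarAlgType R} {H : hilbertModType A}.

Definition adjointable (T : H -> H) : Prop :=
  exists T' : H -> H, forall x y : H,
    inner (T x) y = inner x (T' y) :> A.

Definition linspan (S : set H) : set H :=
  [set x | exists n (s : 'I_n -> H) (k : 'I_n -> (R[i])%C) (a : 'I_n -> A),
     (forall i, S (s i)) /\ x = \sum_(i < n) (k i *: s i + act (a i) (s i))].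

Definition finitely_generated : Prop :=
  exists S : set H, finite_set S /\ linspan S = setT.

Definition countably_generated : Prop :=
  exists S : set H, countable S /\ dense (linspan S).

End HilbertModuleTheory.

Arguments finitely_generated {R A} H.
Arguments countably_generated {R A} H.

(* A sequence indexed by J is given by a total function on nat, whose values   *)
(* outside J are never used. The series over J is summed in the order of nat.  *)
Definition partial_sum (V : nmodType) (J : set nat) (u : nat -> V) : nat -> V :=
  fun n => \sum_(0 <= j < n | j \in J) u j.

Section AtomicSystem.
Context {R : realType} {A : unitalCstarAlgType R} {H : hilbertModType A}.

Definition ell2 (J : set nat) (a : nat -> A) : Prop :=
  cvgn (partial_sum J (fun j => a j ** star (a j))).

Definition atomic_system (J : set nat) (f : nat -> H) (K : H -> H) : Prop :=
  (forall c : nat -> A, ell2 J c ->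
     cvgn (partial_sum J (fun n => act (c n) (f n)))) /\
  (exists C : R, 0 < C /\
     forall x : H, exists a : nat -> A,
       [/\ ell2 J a,
           cstar_le (limn (partial_sum J (fun n => a n ** star (a n))))
                    ((C%:C)%C *: inner x x) &
           partial_sum J (fun n => act (a n) (f n)) @ \oo --> K x]).

End AtomicSystem.

(* Main.v *)
Require Import Defs.
From HB Require Import structures.
From mathcomp Require Import all_boot all_order all_algebra.
From mathcomp Require Import all_classical all_reals all_analysis.
From mathcomp Require Import complex.
From mathcomp Require Import ring lra.

(** Suppose that the module H has a Parseval frame, that is, a sequence g with
    x = sum_n <x, g_n> g_n and <x, x> = sum_n <x, g_n> <g_n, x> for all x.
    Then f_n := K g_n is an atomic system for K, with C = 1 and the
    coefficients a_n := <x, g_n>. Indeed K is bounded, by the uniform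
    boundedness principle ([adjointable_bounded]), so it can be applied to the
    frame expansion term by term; and sum_n c_n g_n converges for every c in
    l2(A), because the Bessel inequality bounds the square of the norm of a
    block of this series by the norm of the same block of sum_n c_n c_n^*
    ([bessel_synthesis]).

    A Parseval frame comes from a regularised Gram-Schmidt process
    ([gram_schmidt_step]). Keep the operator T_n x := x - sum_(i < n) <x, g_i> g_i
    positive. Given a vector eta and e > 0, put q := <T_n eta, eta> and
    g_n := (q + e)^(-1/2) T_n eta. Then T_(n+1) is again positive, it lies below
    T_n, and <T_(n+1) eta, eta> has norm at most e. The summand e is what makes
    the inverse square root exist; geometrically one orthonormalises the
    vectors (eta_n, sqrt(e_n) delta_n) in the direct sum of H and l2(A), and
    projects the result to H. When (eta_n, e_n) runs through all
    pairs of a generator and a tolerance 1/(k+1), T_n s tends to 0 for every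
    generator s; as T_n is A-linear and contractive, it tends to 0 everywhere
    ([exists_parseval_frame]).

    The order of A enters through square roots, the monotonicity of the norm
    and the positivity of a a^*. Spectral positivity does not lend itself to sums
    and limits, so it is replaced by the condition [npos]: a is self-adjoint and
    norm(M - a) <= M for some real M, which visibly defines a convex cone. An
    element with norm(M - a) < M has a square root, by the contraction principle
    ([sqrt_one_sub]). Two self-adjoint commuting elements with
    b^2 + c^2 = M satisfy norm(b)^2 <= M, because b + i c has norm at most sqrt M
    ([nrm_pythagoras]); this stands in for the spectral radius formula.
    It gives the closedness of the cone, and then spectral positivity implies
    [npos]: the set of e >= 0 such that a + e is in the cone is a closed half
    line, and where a + e is invertible it can be continued to the left
    ([npos_of_invertible]). Positivity of a a^* ([npos_mul_star]) is obtained by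
    a quantitative form of the argument of Fukamiya and Kaplansky. *)

Set Implicit Arguments.
Unset Strict Implicit.
Unset Printing Implicit Defensive.

Import Order.TTheory GRing.Theory Num.Theory.
Import numFieldNormedType.Exports.

Local Open Scope classical_set_scope.
Local Open Scope ring_scope.
Local Open Scope complex_scope.

(** * The real Banach space underlying a complex one *)

(** The contraction principle and the uniform boundedness principle concern
    Banach spaces over the reals, and estimates are easier with a norm in R. This
    alias of V carries the same topology and the scalars and norm restricted
    to R. *)
Definition realified (R : realType) (V : completeNormedModType R[i]) : Type := V.

Section Realified.
Context {R : realType} {V : completeNormedModType R[i]}.
Local Notation W := (realified V).

HB.instance Definition _ := GRing.Zmodule.copy W V.
HB.instance Definition _ := Complete.copy W V.
HB.instance Definition _ := Pointed.copy W V.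

Let rnorm (v : W) : R := complex.Re `|v : V|.

Lemma rnormE (v : V) : `|v| = (rnorm v)%:C.
Proof. by rewrite /rnorm RRe_real ?ger0_real. Qed.

Let rnormD (u v : W) : rnorm (u + v) <= rnorm u + rnorm v.
Proof. by rewrite -lecR rmorphD /= -!rnormE ler_normD. Qed.

Let rscale (t : R) (v : W) : W := (t%:C *: (v : V)).

Let rscaleA a b v : rscale a (rscale b v) = rscale (a * b) v.
Proof. by rewrite /rscale scalerA rmorphM. Qed.
Let rscale1 : left_id 1 rscale.
Proof. by move=> v; rewrite /rscale rmorph1 scale1r. Qed.
Let rscaleDr : right_distributive rscale +%R.
Proof. by move=> a u v; rewrite /rscale scalerDr. Qed.
Let rscaleDl v : {morph rscale^~ v : a b / a + b}.
Proof. by move=> a b; rewrite /rscale rmorphD scalerDl. Qed.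

HB.instance Definition _ :=
  GRing.Zmodule_isLmodule.Build R W rscaleA rscale1 rscaleDr rscaleDl.

Let rnorm0 (v : W) : rnorm v = 0 -> v = 0.
Proof. by move=> v0; apply/normr0_eq0; rewrite rnormE v0. Qed.
Let rnormMn (v : W) n : rnorm (v *+ n) = rnorm v *+ n.
Proof. by apply: complexI; rewrite rmorphMn /= -!rnormE normrMn. Qed.
Let rnormN (v : W) : rnorm (- v) = rnorm v.
Proof. by apply: complexI; rewrite -!rnormE normrN. Qed.

HB.instance Definition _ :=
  Num.Zmodule_isNormed.Build R W rnormD rnorm0 rnormMn rnormN.

Let rball (x : W) (e : R) (y : W) : Prop := ball (x : V) e%:C y.
Let rball_center x e : 0 < e -> rball x e x.
Proof. by move=> e0; apply: ballxx; rewrite ltcR. Qed.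
Let rball_sym x y e : rball x e y -> rball y e x.
Proof. exact: ball_sym. Qed.
Let rball_triangle x y z e1 e2 : rball x e1 y -> rball y e2 z -> rball x (e1 + e2) z.
Proof. by rewrite /rball rmorphD; exact: ball_triangle. Qed.
Let rentourageE : @entourage W = entourage_ rball.
Proof.
rewrite -[LHS]/(@entourage V) -entourage_ballE.
apply/seteqP; split => E [e e0 eE].
  exists (complex.Re e); first by move: e0; rewrite /= ltcE => /andP[].
  move=> p pe; apply: eE; rewrite /= in pe *.
  by rewrite -(RRe_real (gtr0_real e0)).
by exists e%:C => //=; rewrite ltcR.
Qed.

HB.instance Definition _ := Uniform_isPseudoMetric.Build R W
  rball_center rball_sym rball_triangle rentourageE.

Let rball_norm : @ball R W = ball_ (fun x : W => `|x|).
Proof.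
rewrite /ball/= /rball; apply/funext => x; apply/funext => e; apply/funext => y.
by rewrite -ball_normE /ball_ /=; apply/propext; rewrite rnormE ltcR.
Qed.
HB.instance Definition _ := NormedZmod_PseudoMetric_eq.Build R W rball_norm.

Let rnormZ (t : R) (v : W) : `|t *: v| = `|t| * `|v|.
Proof.
apply: complexI; rewrite rmorphM /=.
rewrite -[LHS]rnormE normrZ -rnormE; congr (_ * _).
by rewrite normc_def /= expr0n addr0 sqrtr_sqr.
Qed.
HB.instance Definition _ :=
  PseudoMetricNormedZmod_Lmodule_isNormedModule.Build R W rnormZ.
End Realified.

(** The norm as a real number. Its basic laws are restated on V itself, so that
    rewriting never has to compare the additive structures of V and of its
    alias. *)
Definition nrm (R : realType) (V : completeNormedModType R[i]) (v : V) : R :=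
  `|v : realified V|.

Section RealNorm.
Context {R : realType} {V : completeNormedModType R[i]}.
Implicit Types (u v : V) (t : R).

Lemma normE v : `|v| = (nrm v)%:C. Proof. exact: rnormE. Qed.
Lemma nrm_ge0 v : 0 <= nrm v. Proof. exact: normr_ge0. Qed.
Lemma nrm0 : nrm (0 : V) = 0. Proof. exact: normr0. Qed.
Lemma nrmN v : nrm (- v) = nrm v. Proof. exact: (normrN (v : realified V)). Qed.
Lemma nrmD u v : nrm (u + v) <= nrm u + nrm v.
Proof. exact: (ler_normD (u : realified V) v). Qed.
Lemma nrm_distC u v : nrm (u - v) = nrm (v - u).
Proof. exact: (distrC (u : realified V) v). Qed.
Lemma nrm_distD w u v : nrm (u - v) <= nrm (u - w) + nrm (w - v).
Proof. exact: (ler_distD (w : realified V) u v). Qed.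
Lemma nrmZ t v : nrm (t%:C *: v) = `|t| * nrm v.
Proof. exact: (normrZ t (v : realified V)). Qed.
Lemma nrmZp t v : 0 <= t -> nrm (t%:C *: v) = t * nrm v.
Proof. by move=> t0; rewrite nrmZ ger0_norm. Qed.
Lemma nrm_eq0 v : nrm v = 0 -> v = 0.
Proof. by move/(@normr0_eq0 _ (realified V)). Qed.

Lemma nrm_small v : (forall e, 0 < e -> nrm v <= e) -> v = 0.
Proof.
move=> h; apply: nrm_eq0; apply/eqP; rewrite eq_le nrm_ge0 andbT.
by apply/ler_addgt0Pr => e e0; rewrite add0r h.
Qed.

Lemma cvg_nrmP (u : nat -> V) (l : V) :
  (u n @[n --> \oo] --> l) <->
  (forall e : R, 0 < e -> exists N, forall n, (N <= n)%N -> nrm (u n - l) < e).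
Proof.
pose u' : nat -> realified V := u; split=> [h e e0|h].
  have /cvgrPdist_lt/(_ e e0)[N _ Nh] : u' n @[n --> \oo] --> (l : realified V).
    exact: h.
  by exists N => n Nn; rewrite nrm_distC; exact: Nh.
suff : u' n @[n --> \oo] --> (l : realified V) by exact.
apply/cvgrPdist_lt => e e0; have [N Nh] := h e e0.
by exists N => // n /= Nn; rewrite distrC; exact: Nh.
Qed.

Lemma cvgn_nrmP (u : nat -> V) :
  cvgn u <->
  (forall e : R, 0 < e -> exists N, forall m n, (N <= m)%N -> (m <= n)%N ->
    nrm (u n - u m) < e).
Proof.
split=> [/cvg_ex[l /cvg_nrmP h] e e0|h].
  have e2 : 0 < e / 2 by lra.
  have [N hN] := h _ e2.
  exists N => m n Nm mn; have := nrm_distD l (u n) (u m).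
  have := hN m Nm; have := hN n (leq_trans Nm mn).
  by rewrite (nrm_distC l); lra.
pose u' : nat -> realified V := u; suff : cvgn u' by exact.
apply/cauchy_cvgP; apply/cauchy_ballP => e e0; near_simpl.
have [N hN] := h e e0; exists ([set n | N <= n], [set n | N <= n])%N.
  by split; exists N.
move=> [n m] [/= Nn Nm]; rewrite -ball_normE /=.
have [mn|nm] := leqP m n; first exact: hN.
by rewrite distrC; apply: hN => //; exact: ltnW.
Qed.

(** The limit of the iterates from 0 is kept in the conclusion: any closed
    condition which F preserves, such as self-adjointness or commuting with a
    given element, passes to the fixed point. *)
Lemma ball_fixpoint (F : V -> V) (rho r : R) : 0 <= rho -> 0 <= r < 1 ->
  (forall v, nrm v <= rho -> nrm (F v) <= rho) ->
  (forall u v, nrm u <= rho -> nrm v <= rho ->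
    nrm (F u - F v) <= r * nrm (u - v)) ->
  exists y, [/\ nrm y <= rho, F y = y & iter n F 0 @[n --> \oo] --> y].
Proof.
move=> rho0 /andP[r0 r1] Fball Flip.
pose W := realified V; pose U : set W := [set v | `|v| <= rho].
have FU : set_fun U U (F : W -> W) by move=> v; exact: Fball.
pose f : {fun U >-> U} := HB.pack (F : W -> W) (isFun.Build _ _ _ _ _ FU).
have ctrf : contraction (NngNum r0) f.
  by split=> // -[u v] [/= Uu Uv]; exact: Flip.
have U0 : U (0 : W) by rewrite /U /= normr0.
have clU : closed U.
  rewrite (_ : U = (@Num.norm R W : W -> R) @^-1` [set x | x <= rho]) //.
  by apply: preimage_closed (@closed_le _ _) => v _; exact: norm_continuous.
have cv := contraction_cvg ctrf U0.
exists (limn (fun n => iter n f (0 : W))); split => //.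
- apply: (@closed_cvg _ W _ _ _ U) cv => //; apply: nearW.
  by elim=> //= n; exact: Fball.
- exact/esym/(contraction_cvg_fixed ctrf U0 clU).
Qed.

End RealNorm.

(** * Linear identities by comparison of coefficients *)

Section LinearIdentities.
Context {K : comNzRingType} {V : lmodType K}.

(** Products of elements of A have no commutative normal form, but after
    distributing them every identity below is linear over R[i] in the remaining
    monomials. The tactic [lmod] proves such an identity by comparing the
    coefficients of each monomial, which are elements of a commutative ring. *)
Inductive lexpr :=
  | LAtom of nat | LZero | LAdd of lexpr & lexpr | LOpp of lexpr | LScale of K & lexpr.

Fixpoint leval (env : seq V) (e : lexpr) : V :=
  match e with
  | LAtom n => env`_n
  | LZero => 0
  | LAdd e1 e2 => leval env e1 + leval env e2
  | LOpp e1 => - leval env e1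
  | LScale k e1 => k *: leval env e1
  end.

Fixpoint lcoef (n : nat) (e : lexpr) : K :=
  match e with
  | LAtom m => if Nat.eqb m n then 1 else 0
  | LZero => 0
  | LAdd e1 e2 => lcoef n e1 + lcoef n e2
  | LOpp e1 => - lcoef n e1
  | LScale k e1 => k * lcoef n e1
  end.

Fixpoint lcoefs_eq (n : nat) (e1 e2 : lexpr) : Prop :=
  match n with
  | 0 => True
  | m.+1 => lcoef m e1 = lcoef m e2 /\ lcoefs_eq m e1 e2
  end.

Lemma levalE env e : leval env e = \sum_(n < size env) lcoef n e *: env`_n.
Proof.
elim: e => /= [m| |e1 -> e2 ->|e1 ->|k e1 ->].
- have [lt_m|ge_m] := ltnP m (size env).
    rewrite (bigD1 (Ordinal lt_m)) //= PeanoNat.Nat.eqb_refl scale1r big1 ?addr0 //.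
    move=> i /eqP ne; case: PeanoNat.Nat.eqb_spec => [e|]; last by rewrite scale0r.
    by case: ne; apply/val_inj.
  rewrite nth_default // big1 // => i _.
  case: PeanoNat.Nat.eqb_spec => [e|]; last by rewrite scale0r.
  by have := ltn_ord i; rewrite -e ltnNge ge_m.
- by rewrite big1 // => i _; rewrite scale0r.
- by rewrite -big_split; apply: eq_bigr => i _; rewrite scalerDl.
- by rewrite -sumrN; apply: eq_bigr => i _; rewrite scaleNr.
- by rewrite scaler_sumr; apply: eq_bigr => i _; rewrite scalerA.
Qed.

Lemma lcoefs_eqP env e1 e2 :
  lcoefs_eq (size env) e1 e2 -> leval env e1 = leval env e2.
Proof.
rewrite !levalE => h; apply: eq_bigr => -[i /= lt_i] _; congr (_ *: _).
elim: (size env) h lt_i => //= n IH [en h].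
by rewrite ltnS leq_eqVlt => /orP[/eqP-> //|]; exact: IH.
Qed.

End LinearIdentities.

Ltac lmod_index x l :=
  match l with
  | ?y :: ?l' => match constr:(Set) with
    | _ => let _ := match constr:(Set) with _ => unify x y end in constr:(O)
    | _ => let n := lmod_index x l' in constr:(S n)
    end
  end.
Ltac lmod_insert x l :=
  match constr:(Set) with
  | _ => let _ := lmod_index x l in l
  | _ => constr:(x :: l)
  end.
Ltac lmod_atoms e l :=
  lazymatch e with
  | (?a + ?b)%R => let l := lmod_atoms a l in lmod_atoms b l
  | (- ?a)%R => lmod_atoms a l
  | (?k *: ?a)%R => lmod_atoms a l
  | (0)%R => l
  | _ => lmod_insert e l
  end.
Ltac lmod_reify K e l :=
  lazymatch e with
  | (?a + ?b)%R =>
    let ra := lmod_reify K a l in let rb := lmod_reify K b l in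
    constr:(@LAdd K ra rb)
  | (- ?a)%R => let ra := lmod_reify K a l in constr:(@LOpp K ra)
  | (?k *: ?a)%R => let ra := lmod_reify K a l in constr:(@LScale K k ra)
  | (0)%R => constr:(@LZero K)
  | _ => let n := lmod_index e l in constr:(@LAtom K n)
  end.
Ltac lmod_coefs R :=
  lazymatch goal with |- @eq ?V ?x ?y =>
    let K := constr:(R[i] : comNzRingType) in
    let l := lmod_atoms x (@nil V) in let l := lmod_atoms y l in
    let ex := lmod_reify K x l in let ey := lmod_reify K y l in
    apply: (@lcoefs_eqP K V l ex ey); cbn [lcoefs_eq lcoef size Nat.eqb];
    repeat split
  end.
Tactic Notation "lmod" constr(R) :=
  lmod_coefs R; first [ring | field]; rewrite ?fmorph_eq0 //.

(** * Inverses and square roots in a unital C*-algebra *)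

Section CstarBasics.
Context {R : realType} {A : unitalCstarAlgType R}.
Implicit Types (a b c g y : A) (t : R).
Local Notation one := (@cone R A).

Lemma cmulNl a b : (- a) ** b = - (a ** b).
Proof. by rewrite -scaleN1r cmulZl scaleN1r. Qed.
Lemma cmulNr a b : a ** (- b) = - (a ** b).
Proof. by rewrite -scaleN1r cmulZr scaleN1r. Qed.
Lemma cmul0l a : 0 ** a = 0.
Proof. by rewrite -[in LHS](scale0r (0 : A)) cmulZl scale0r. Qed.
Lemma cmul0r a : a ** 0 = 0.
Proof. by rewrite -[in LHS](scale0r (0 : A)) cmulZr scale0r. Qed.
Definition cmulE := (@cmulDl R A, @cmulDr R A, cmulNl, cmulNr, @cmulZl R A,
  @cmulZr R A, @cmul1l R A, @cmul1r R A, cmul0l, cmul0r, @cmulA R A).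

Lemma star0 : star 0 = 0 :> A.
Proof. by rewrite -[in LHS](scale0r (0 : A)) starZ rmorph0 scale0r. Qed.
Lemma starN a : star (- a) = - star a.
Proof. by rewrite -scaleN1r starZ rmorphN rmorph1 scaleN1r. Qed.
Lemma star1 : star one = one.
Proof. by rewrite -[LHS]cmul1l -{1}(starK one) -starM cmul1l starK. Qed.
Lemma starZr t a : star (t%:C *: a) = t%:C *: star a.
Proof. by rewrite starZ; congr (_ *: _); apply/CrealP/complex_realP; exists t. Qed.
Lemma starZi a : star ('i *: a) = - ('i *: star a).
Proof.
rewrite starZ -scaleNr; congr (_ *: _).
by apply/eqP; rewrite eq_complex /= ?oppr0 ?eqxx.
Qed.
Definition starE := (@starD R A, starN, starZr, starZi, @starM R A, star0, star1).

Lemma nrmM a b : nrm (a ** b) <= nrm a * nrm b.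
Proof. by rewrite -lecR rmorphM /= -!normE cnormM. Qed.
Lemma nrm_starM a : nrm (star a ** a) = nrm a ^+ 2.
Proof. by apply: complexI; rewrite rmorphXn /= -!normE cstar_identity. Qed.

Lemma nrm_star a : nrm (star a) = nrm a.
Proof.
have le b : nrm b <= nrm (star b).
  have [->|b0] := eqVneq (nrm b) 0; first exact: nrm_ge0.
  have b_gt0 : 0 < nrm b by rewrite lt_def b0 nrm_ge0.
  by rewrite -(ler_pM2r b_gt0) -expr2 -nrm_starM nrmM.
by apply: le_anti; rewrite le andbT -{2}(starK a) le.
Qed.

Lemma nrm_sqr_sa a : star a = a -> nrm (a ** a) = nrm a ^+ 2.
Proof. by move=> sa; rewrite -nrm_starM sa. Qed.

Lemma nrm1 : nrm one <= 1.
Proof.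
have := nrm_starM one; rewrite star1 cmul1l expr2 => e.
have := nrm_ge0 one; nra.
Qed.

Lemma nrm_real t : 0 <= t -> nrm (t%:C *: one) <= t.
Proof. by move=> t0; rewrite nrmZp // ler_piMr // nrm1. Qed.

(** The inverse x of 1 - y is the fixed point of x |-> 1 + y x. The map
    x |-> 1 + x y gives an inverse on the other side. *)
Lemma neumann y : nrm y < 1 -> invertible (one - y).
Proof.
move=> y1; have y0 := nrm_ge0 y.
have [rho [rho0 rhoE]] : exists rho : R, 0 <= rho /\ 1 + nrm y * rho <= rho.
  have d : 1 - nrm y != 0 by rewrite subr_eq0 eq_sym lt_eqF.
  have d0 : 0 < 1 - nrm y by rewrite subr_gt0.
  exists (1 - nrm y)^-1; split; first by rewrite invr_ge0 ltW.
  by rewrite le_eqVlt; apply/orP; left; apply/eqP; field.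
have y01 : 0 <= nrm y < 1 by rewrite y0.
have [x [_ xE _]] : exists x, [/\ nrm x <= rho, one + y ** x = x &
    iter n (fun x => one + y ** x) 0 @[n --> \oo] --> x].
  apply: (ball_fixpoint rho0 y01) => [v v_le|u v _ _].
    have := nrmD one (y ** v); have := nrmM y v; have := nrm1; nra.
  rewrite (_ : _ - _ = y ** (u - v)) ?nrmM //.
  by rewrite ?cmulE; lmod R.
have [z [_ zE _]] : exists x, [/\ nrm x <= rho, one + x ** y = x &
    iter n (fun x => one + x ** y) 0 @[n --> \oo] --> x].
  apply: (ball_fixpoint rho0 y01) => [v v_le|u v _ _].
    have := nrmD one (v ** y); have := nrmM v y; have := nrm1; nra.
  rewrite (_ : _ - _ = (u - v) ** y); first by rewrite mulrC nrmM.
  by rewrite ?cmulE; lmod R.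
have xR : (one - y) ** x = one.
  by rewrite cmulDl cmul1l cmulNl -{1}xE; lmod R.
have zL : z ** (one - y) = one.
  by rewrite cmulDr cmul1r cmulNr -{1}zE; lmod R.
exists x; split=> //.
suff -> : x = z by [].
by rewrite -[LHS]cmul1l -zL -cmulA xR cmul1r.
Qed.

Lemma commute_lim g (u : nat -> A) y : u n @[n --> \oo] --> y ->
  (forall n, g ** u n = u n ** g) -> g ** y = y ** g.
Proof.
move=> /cvg_nrmP uy gu; apply/eqP; rewrite -subr_eq0; apply/eqP/nrm_small => e e0.
have g0 := nrm_ge0 g.
have d0 : 0 < e / (2 * nrm g + 1) by rewrite divr_gt0 //; lra.
have [N /(_ N (leqnn _)) uN] := uy _ d0.
rewrite (_ : _ - _ = (u N - y) ** g - g ** (u N - y)); last first.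
  by rewrite ?cmulE gu; lmod R.
have := nrmD ((u N - y) ** g) (- (g ** (u N - y))); rewrite nrmN.
have := nrmM (u N - y) g; have := nrmM g (u N - y).
move: uN; rewrite ltr_pdivlMr; last lra.
have := nrm_ge0 (u N - y); nra.
Qed.

Lemma sa_lim (u : nat -> A) y : u n @[n --> \oo] --> y ->
  (forall n, star (u n) = u n) -> star y = y.
Proof.
move=> /cvg_nrmP uy su; apply/eqP; rewrite -subr_eq0; apply/eqP/nrm_small => e e0.
have d0 : 0 < e / 2 by lra.
have [N /(_ N (leqnn _)) uN] := uy _ d0.
rewrite (_ : _ - _ = (u N - y) - star (u N - y)); last first.
  by rewrite !starE su; lmod R.
have := nrmD (u N - y) (- star (u N - y)); rewrite nrmN nrm_star; lra.
Qed.

(** (1 - y)^2 = 1 - a amounts to y = (a + y^2)/2, and the right hand side is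
    a contraction of the ball of radius 1 - sqrt (1 - norm a) < 1. *)
Lemma sqrt_one_sub a : nrm a < 1 ->
  exists y, [/\ nrm y < 1, (one - y) ** (one - y) = one - a,
    (forall g, g ** a = a ** g -> g ** y = y ** g) &
    (star a = a -> star y = y)].
Proof.
move=> a1; pose s := Num.sqrt (1 - nrm a); pose r := 1 - s.
have s_sqr : s ^+ 2 = 1 - nrm a by rewrite sqr_sqrtr // subr_ge0 ltW.
have s_gt0 : 0 < s by rewrite sqrtr_gt0 subr_gt0.
have a0 := nrm_ge0 a.
have rE : nrm a = 2 * r - r ^+ 2 by rewrite /r; nra.
have r01 : 0 <= r < 1 by rewrite /r; apply/andP; split; nra.
have /andP[r0 r1] := r01.
(* On the ball of radius r, F has Lipschitz constant r since
   u^2 - v^2 = u (u - v) + (u - v) v, and it maps this ball to itself since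
   norm a + r^2 = 2 r. *)
pose F v := (2^-1)%:C *: (a + v ** v).
have [y [y_le yE y_lim]] : exists y, [/\ nrm y <= r, F y = y &
    iter n F 0 @[n --> \oo] --> y].
  apply: (ball_fixpoint r0 r01) => [v v_le|u v u_le v_le].
    rewrite nrmZp; last lra.
    have := nrmD a (v ** v); have := nrmM v v; have := nrm_ge0 v; nra.
  rewrite (_ : _ - _ = (2^-1)%:C *: (u ** (u - v) + (u - v) ** v)); last first.
    by rewrite /F ?cmulE; lmod R.
  rewrite nrmZp; last lra.
  have := nrmD (u ** (u - v)) ((u - v) ** v).
  have := nrmM u (u - v); have := nrmM (u - v) v; have := nrm_ge0 (u - v); nra.
exists y; split.
- exact: le_lt_trans y_le r1.
- have -> : a = 2%:C *: y - y ** y by rewrite -{1}yE /F; lmod R.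
  by rewrite ?cmulE; lmod R.
- move=> g ga; apply: commute_lim y_lim _; elim=> [|n IH] /=.
    by rewrite cmul0l cmul0r.
  by rewrite /F ?cmulE ga IH -cmulA IH cmulA.
- move=> sa; apply: sa_lim y_lim _; elim=> [|n IH] /=; first exact: star0.
  by rewrite /F !starE sa IH.
Qed.

End CstarBasics.

(** * The positive cone *)

Section Positive.
Context {R : realType} {A : unitalCstarAlgType R}.
Implicit Types (a b c g p z : A) (t M e : R).
Local Notation one := (@cone R A).

(** The positive cone, described by the norm. If M works then so does every
    larger number; therefore sums of positive elements are positive. *)
Definition npos a : Prop :=
  star a = a /\ exists M : R, nrm (M%:C *: one - a) <= M.

Lemma npos_sa a : npos a -> star a = a. Proof. by case. Qed.

Lemma nposD a b : npos a -> npos b -> npos (a + b).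
Proof.
move=> [sa [M aM]] [sb [N bN]]; split; first by rewrite starD sa sb.
exists (M + N); rewrite (_ : _ - _ = (M%:C *: one - a) + (N%:C *: one - b)).
  by apply: le_trans (nrmD _ _) _; rewrite lerD.
by rewrite rmorphD /=; lmod R.
Qed.

Lemma nposZ t a : 0 <= t -> npos a -> npos (t%:C *: a).
Proof.
move=> t0 [sa [M aM]]; split; first by rewrite starZr sa.
exists (t * M); rewrite (_ : _ - _ = t%:C *: (M%:C *: one - a)).
  by rewrite nrmZp // ler_wpM2l.
by rewrite rmorphM /=; lmod R.
Qed.

Lemma npos_real_sub M a : star a = a -> nrm a <= M -> npos (M%:C *: one - a).
Proof.
move=> sa aM; split; first by rewrite !starE sa.
by exists M; rewrite (_ : _ - _ = a) //; lmod R.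
Qed.

Lemma npos_real t : 0 <= t -> npos (t%:C *: one).
Proof.
move=> t0; rewrite -[X in npos X]subr0; apply: npos_real_sub; first exact: star0.
by rewrite nrm0.
Qed.

Lemma npos_sum (I : Type) (r : seq I) (F : I -> A) :
  (forall i, npos (F i)) -> npos (\sum_(i <- r) F i).
Proof.
move=> pF; elim: r => [|i r IH]; last by rewrite big_cons; exact: nposD.
rewrite big_nil; have := npos_real (lexx 0).
by rewrite rmorph0 scale0r.
Qed.

Lemma invertibleM a b : invertible a -> invertible b -> invertible (a ** b).
Proof.
move=> [x [ax xa]] [y [b_y yb]]; exists (y ** x); split.
  by rewrite cmulA -(cmulA a) b_y cmul1r.
by rewrite cmulA -(cmulA y) xa cmul1r.
Qed.

Lemma invertible_factor a b : a ** b = b ** a -> invertible (a ** b) -> invertible a.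
Proof.
move=> ab [x [abx xab]]; exists (b ** x); split; first by rewrite cmulA.
have -> : b ** x = x ** b.
  rewrite -[RHS]cmul1r -abx !cmulA -(cmulA x b a) -ab xab cmul1l.
  by [].
by rewrite -cmulA -ab.
Qed.

Lemma invertibleZ t a : t != 0 -> invertible a -> invertible (t%:C *: a).
Proof.
move=> t0 [x [ax xa]]; exists ((t^-1)%:C *: x).
by rewrite !cmulE ax xa !scalerA -!rmorphM /= mulfV // mulVf // rmorph1 scale1r.
Qed.

(** The root is sqrt M (1 - y), where (1 - y)^2 = a / M. *)
Lemma sqrt_near_real M a : star a = a -> nrm (M%:C *: one - a) < M ->
  exists r, [/\ star r = r, r ** r = a, invertible r, npos r &
    forall g, g ** a = a ** g -> g ** r = r ** g].
Proof.
move=> sa aM; have M0 : 0 < M by apply: le_lt_trans aM; exact: nrm_ge0.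
have Mn0 : M != 0 by rewrite gt_eqF.
pose t := one - (M^-1)%:C *: a.
have t1 : nrm t < 1.
  have -> : t = (M^-1)%:C *: (M%:C *: one - a) by rewrite /t; lmod R.
  by rewrite nrmZp ?invr_ge0 ?ltW // mulrC ltr_pdivrMr // mul1r.
have [y [y1 yE yC ySA]] := sqrt_one_sub t1.
pose s := Num.sqrt M; have s2 : s%:C * s%:C = M%:C.
  by rewrite -rmorphM -expr2 sqr_sqrtr // ltW.
have s0 : 0 < s by rewrite sqrtr_gt0.
exists (s%:C *: (one - y)); split.
- by rewrite !starE ySA // /t !starE sa.
- by rewrite cmulZl cmulZr scalerA s2 yE /t; lmod R.
- by apply: invertibleZ; [rewrite gt_eqF | exact: neumann].
- split; first by rewrite !starE ySA // /t !starE sa.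
  exists s; rewrite (_ : _ - _ = s%:C *: y); last by lmod R.
  by rewrite (nrmZp _ (ltW s0)) ler_piMr // ltW.
- move=> g ga; have gy : g ** y = y ** g by apply: yC; rewrite /t !cmulE ga.
  by rewrite !cmulE gy.
Qed.

Lemma npos_sqrt e a : 0 < e -> npos a ->
  exists r, [/\ star r = r, r ** r = a + e%:C *: one, invertible r, npos r &
    forall g, g ** a = a ** g -> g ** r = r ** g].
Proof.
move=> e0 [sa [M aM]].
have [||r [sr rE ir pr rC]] := @sqrt_near_real (M + e) (a + e%:C *: one).
- by rewrite !starE sa.
- rewrite (_ : _ - _ = M%:C *: one - a); last by rewrite rmorphD /=; lmod R.
  lra.
exists r; split=> // g ga; apply: rC; rewrite !cmulE ga; lmod R.
Qed.

Lemma npos_invertible e a : 0 < e -> npos a -> invertible (a + e%:C *: one).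
Proof. by move=> e0 /(npos_sqrt e0)[r [_ <- ir _ _]]; exact: invertibleM. Qed.

(** The element z := b + i c satisfies z^* z = b^2 + c^2 = M, and b is the real
    part of z. *)
Lemma nrm_pythagoras M b c : 0 <= M -> star b = b -> star c = c ->
  b ** c = c ** b -> b ** b + c ** c = M%:C *: one -> nrm b ^+ 2 <= M.
Proof.
move=> M0 sb sc bc bcM; pose z := b + 'i *: c.
have sz : star z = b - 'i *: c by rewrite !starE sb sc.
have zM : nrm z ^+ 2 <= M.
  rewrite -nrm_starM sz (_ : _ ** _ = M%:C *: one) ?nrm_real //.
  rewrite -bcM !cmulE bc; lmod_coefs R; try ring.
  by rewrite !(mulr0, mulr1) -expr2 sqr_i; ring.
have zb : 2 * nrm b <= nrm z + nrm z.
  rewrite -[X in _ <= _ + X]nrm_star -nrmZp; last by lra.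
  have -> : 2%:C *: b = z + star z by rewrite sz /z; lmod R.
  exact: nrmD.
have := nrm_ge0 b; nra.
Qed.

(** M - b^2 has a square root c which commutes with b, so that
    b^2 + c^2 = M bounds the norm of c. *)
Lemma nrm_real_sub_sqr M b : star b = b -> nrm b ^+ 2 < M ->
  nrm (M%:C *: one - b ** b) <= M.
Proof.
move=> sb bM.
have [||r [sr rE _ _ rC]] := @sqrt_near_real M (M%:C *: one - b ** b).
- by rewrite !starE sb.
- rewrite (_ : _ - _ = b ** b) ?nrm_sqr_sa //; lmod R.
have M0 : 0 <= M by apply: le_trans (ltW bM); exact: sqr_ge0.
rewrite -rE nrm_sqr_sa //; apply: (nrm_pythagoras M0 sr sb).
  by apply/esym/rC; rewrite !cmulE.
by rewrite rE; lmod R.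
Qed.

Lemma npos_sqr b : star b = b -> npos (b ** b).
Proof.
move=> sb; split; first by rewrite starM sb.
exists (nrm b ^+ 2 + 1); apply: nrm_real_sub_sqr => //; lra.
Qed.

(** The constant in the definition of [npos] may always be taken close to the
    norm of a, and this uniformity makes the cone closed. *)
Lemma npos_nrm_real_sub M a : npos a -> nrm a <= M -> nrm (M%:C *: one - a) <= M.
Proof.
move=> pa aM; apply/ler_addgt0Pr => e' e'0.
pose e := e' / 3; have e0 : 0 < e by rewrite /e; lra.
have [r [sr rE _ _ _]] := npos_sqrt e0 pa.
have rM : nrm r ^+ 2 < M + 2 * e.
  rewrite -nrm_sqr_sa // rE; have := nrmD a (e%:C *: one).
  by have := @nrm_real _ A _ (ltW e0); lra.
have := nrm_real_sub_sqr sr rM; rewrite rE.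
rewrite (_ : M%:C *: one - a =
  ((M + 2 * e)%:C *: one - (a + e%:C *: one)) - e%:C *: one); last first.
  by rewrite rmorphD rmorphM /=; lmod R.
move: (_ - (_ + _)) => u.
have := nrmD u (- (e%:C *: one)); rewrite nrmN.
by have := @nrm_real _ A _ (ltW e0); rewrite /e; lra.
Qed.

Lemma npos_closed a : star a = a ->
  (forall e, 0 < e -> exists2 b, npos b & nrm (b - a) <= e) -> npos a.
Proof.
move=> sa h; split=> //; exists (nrm a + 1).
apply/ler_addgt0Pr => e' e'0.
(* e <= 1 keeps norm b <= norm a + 1, so that one constant serves for all the
   approximations b. *)
pose e := Num.min e' 1.
have e0 : 0 < e by rewrite /e lt_min e'0 ltr01.
have [b pb ba] := h e e0.
have [ee' e1] : e <= e' /\ e <= 1 by rewrite /e !ge_min !lexx orbT.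
have bM : nrm b <= nrm a + 1.
  have := nrmD (b - a) a; rewrite subrK; lra.
have := npos_nrm_real_sub pb bM.
rewrite (_ : _ *: _ - a = ((nrm a + 1)%:C *: one - b) + (b - a)); last by lmod R.
move: (_ *: _ - b) => u; have := nrmD u (b - a); lra.
Qed.

Lemma npos_closed_add a : (forall e, 0 < e -> npos (a + e%:C *: one)) -> npos a.
Proof.
move=> h; apply: npos_closed => [|e e0].
  have := npos_sa (h 1 ltr01); rewrite !starE => /eqP.
  by rewrite (inj_eq (addIr _)) => /eqP.
exists (a + e%:C *: one); first exact: h.
by rewrite addrAC subrr add0r; apply: nrm_real; exact: ltW.
Qed.

(** Invertible positive elements are interior to the cone. For small d,
    1 - d a^-1 has a square root v which commutes with a, and a - d = v a v is
    positive as a limit of squares (r v)^2, where r^2 = a + e. *)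
Lemma npos_invertible_sub a : npos a -> invertible a ->
  exists2 d : R, 0 < d & npos (a - d%:C *: one).
Proof.
move=> pa [b [ab ba]]; have sa := npos_sa pa.
have sb : star b = b.
  have sba : star b ** a = one by rewrite -{1}sa -starM ab star1.
  by rewrite -[LHS]cmul1r -ab cmulA sba cmul1l.
have b0 := nrm_ge0 b.
pose d := (nrm b + 1)^-1; have d0 : 0 < d by rewrite invr_gt0; lra.
have db1 : nrm (d%:C *: b) < 1.
  rewrite (nrmZp _ (ltW d0)) /d mulrC ltr_pdivrMr; lra.
have [y [_ yE yC ySA]] := sqrt_one_sub db1.
pose v := one - y; rewrite -/v in yE.
have sv : star v = v by rewrite !starE ySA // starZr sb.
have av : a ** v = v ** a.
  by rewrite /v !cmulE yC // !cmulE ab ba.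
clearbody v; exists d => //; apply: npos_closed => [|e e0]; first by rewrite !starE sa.
have h0 : 0 < e / 2 by lra.
have [r [sr rE _ _ rC]] := npos_sqrt h0 pa.
have rv : v ** r = r ** v by rewrite rC.
exists ((r ** v) ** (r ** v)); first by apply: npos_sqr; rewrite starM sr sv.
rewrite -{1}rv cmulA -(cmulA v r) rE.
have -> : v ** (a + (e / 2)%:C *: one) ** v - (a - d%:C *: one) =
   (e / 2)%:C *: (one - d%:C *: b).
  rewrite !cmulE -av -!(cmulA _ v v) yE !cmulE ab; lmod R.
rewrite (nrmZp _ (ltW h0)).
have := nrmD one (- (d%:C *: b)); rewrite nrmN; have := @nrm1 _ A.
nra.
Qed.

(** The numbers e >= 0 with a + e positive form a closed half line. Its end
    point m is 0: otherwise a + m is invertible and positive, hence a + m - d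
    is still positive for some d > 0. *)
Lemma npos_of_invertible a : star a = a ->
  (forall e, 0 < e -> invertible (a + e%:C *: one)) -> npos a.
Proof.
move=> sa inv_a.
pose E : set R := [set e | 0 <= e /\ npos (a + e%:C *: one)].
have Emono t t' : E t -> t <= t' -> E t'.
  move=> [t0 pt] tt'; split; first exact: le_trans tt'.
  rewrite (_ : a + _ = (a + t%:C *: one) + (t' - t)%:C *: one).
    by apply: nposD => //; apply: npos_real; rewrite subr_ge0.
  by rewrite rmorphB /=; lmod R.
have EM : E (nrm a).
  split; first exact: nrm_ge0.
  have := @npos_real_sub (nrm a) (- a); rewrite nrmN starN sa opprK addrC.
  exact.
have infE : has_inf E by split; [exists (nrm a) | exists 0 => x []].
pose m := inf E.
have m0 : 0 <= m by apply: lb_le_inf; [exists (nrm a) | move=> x []].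
have pm : npos (a + m%:C *: one).
  apply: npos_closed_add => e e0.
  have [t Et tm] := inf_adherent e0 infE.
  by have [_] := Emono _ _ Et (ltW tm); rewrite rmorphD scalerDl addrA.
have [m_eq0|m_neq0] := eqVneq m 0.
  by move: pm; rewrite m_eq0 rmorph0 scale0r addr0.
have m_gt0 : 0 < m by rewrite lt_def m_neq0.
have [d d0 pd] := npos_invertible_sub pm (inv_a _ m_gt0).
pose m' := Num.max 0 (m - d).
have : E m'.
  split; first by rewrite /m' le_max lexx.
  rewrite (_ : a + _ = (a + m%:C *: one - d%:C *: one) + (m' - (m - d))%:C *: one).
    by apply: nposD => //; apply: npos_real; rewrite subr_ge0 /m' le_max lexx orbT.
  by rewrite !rmorphB /=; lmod R.
move=> /(ge_inf infE.2); rewrite -/m leNgt => /negP[].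
by rewrite /m' gt_max m_gt0 /=; lra.
Qed.

Lemma cstar_pos_npos a : cstar_pos a -> npos a.
Proof.
move=> [sa spa]; apply: npos_of_invertible => // e e0; apply: contrapT => ninv.
have : spectrum a (- e%:C).
  move=> inv; apply: ninv.
  have := @invertibleZ (- 1) _ _ inv; rewrite oppr_eq0 oner_eq0 => /(_ isT).
  by congr invertible; rewrite rmorphN rmorph1; lmod R.
move/spa; rewrite oppr_ge0 -(rmorph0 (real_complex R)) lecR; lra.
Qed.

(** If x inverts c^* c + t then t^-1 (1 - c x c^* ) inverts c c^* + t. *)
Lemma invertible_swap t c : t != 0 ->
  invertible (star c ** c + t%:C *: one) -> invertible (c ** star c + t%:C *: one).
Proof.
move=> t0 [x [xr xl]]; exists ((t^-1)%:C *: (one - c ** x ** star c)).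
have xr' : c ** (star c ** c + t%:C *: one) ** x ** star c = c ** star c.
  by rewrite -(cmulA c) xr cmul1r.
have xl' : c ** x ** (star c ** c + t%:C *: one) ** star c = c ** star c.
  by rewrite -(cmulA c) xl cmul1r.
split; [move: xr' | move: xl']; rewrite !cmulE => e.
  have -> : c ** star c ** c ** x ** star c =
      c ** star c - t%:C *: (c ** x ** star c) by apply/eqP; rewrite eq_sym subr_eq e.
  by lmod R.
have -> : c ** x ** star c ** c ** star c =
    c ** star c - t%:C *: (c ** x ** star c) by apply/eqP; rewrite eq_sym subr_eq e.
by lmod R.
Qed.

(** A square root c of M - z^2 + e commutes with z, and z^2 + c^2 = M + e. *)
Lemma nrm_le_of_sqr M z : star z = z -> 0 <= M -> npos (M%:C *: one - z ** z) ->
  nrm z ^+ 2 <= M.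
Proof.
move=> sz M0 pz; apply/ler_addgt0Pr => e e0.
have [c [sc cE _ _ cC]] := npos_sqrt e0 pz.
apply: (@nrm_pythagoras _ z c _ sz sc); first lra.
- by apply: cC; rewrite !cmulE.
- by rewrite cE rmorphD /=; lmod R.
Qed.

Lemma npos_le_nrm M a : 0 <= M -> npos a -> npos (M%:C *: one - a) -> nrm a <= M.
Proof.
move=> M0 pa pMa; apply/ler_addgt0Pr => e' e'0.
pose e := e' / 2; have e0 : 0 < e by rewrite /e; lra.
have [s [ss sE _ _ _]] := npos_sqrt e0 pa.
have : nrm s ^+ 2 <= M + e.
  apply: nrm_le_of_sqr => //; first lra.
  by rewrite sE (_ : _ - _ = M%:C *: one - a) // rmorphD /=; lmod R.
rewrite -nrm_sqr_sa // sE.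
have -> : a = (a + e%:C *: one) - e%:C *: one by lmod R.
move: (a + _) => u; have := nrmD u (- (e%:C *: one)); rewrite nrmN.
by rewrite subrK; have := @nrm_real _ A _ (ltW e0); rewrite /e; lra.
Qed.

(** b is at most its norm, hence so is a. *)
Lemma nrm_mono a b : npos a -> npos (b - a) -> nrm a <= nrm b.
Proof.
move=> pa pba; apply: npos_le_nrm => //; first exact: nrm_ge0.
have sb : star b = b.
  by have := npos_sa (nposD pba pa); rewrite subrK.
rewrite (_ : _ - a = ((nrm b)%:C *: one - b) + (b - a)); last by lmod R.
by apply: nposD => //; apply: npos_real_sub.
Qed.

(** This is half the sum of the squares of the self-adjoint elements c + c^*
    and i (c - c^* ). *)
Lemma npos_add_conj_sqr c : npos (c ** star c + star c ** c).
Proof.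
pose u := c + star c; pose v := 'i *: (c - star c).
have su : star u = u by rewrite /u !starE starK addrC.
have sv : star v = v by rewrite /v !starE starK; lmod R.
have -> : c ** star c + star c ** c = (2^-1)%:C *: (u ** u + v ** v).
  by rewrite /u /v !cmulE; lmod_coefs R; rewrite -mulrBr mulrA -expr2 sqr_i; field.
apply: nposZ; first by rewrite invr_ge0.
by apply: nposD; apply: npos_sqr.
Qed.

(** Let b := c c^*, let r be a square root of b^2 + e^2, an approximation of the
    absolute value of b, and let d := r - b, which is nearly twice the negative
    part of b. As (r - b) (r + b) = e^2, the element d is positive and
    invertible. For s^2 = d and w := s c one gets w w^* = (e^2 - d^2)/2, which is
    almost negative; hence w^* w is almost positive by [npos_add_conj_sqr], and
    then so is w w^* by [invertible_swap]. Therefore d^2 <= 2 e^2, and b is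
    within 2 e of the positive element r. *)
Lemma npos_mul_star c : npos (c ** star c).
Proof.
(* The auxiliary elements are introduced by equations, so that distributing a
   product of their names does not unfold them. *)
have [b bE] : exists b, b = c ** star c by eexists.
have sb : star b = b by rewrite bE starM starK.
rewrite -bE.
apply: npos_closed => // e' e'0.
pose e := e' / 2; have e0 : 0 < e by rewrite /e; lra.
have e2_gt0 : 0 < e ^+ 2 by rewrite exprn_gt0.
have [r [sr rE _ pr rC]] := npos_sqrt e2_gt0 (npos_sqr sb).
have br : b ** r = r ** b by apply: rC; rewrite cmulA.
have [d dE] : exists d, d = r - b by eexists.
have [d' d'E] : exists d', d' = r + b by eexists.
have sd : star d = d by rewrite dE !starE sr sb.
have dd' : d ** d' = (e ^+ 2)%:C *: one by rewrite dE d'E !cmulE rE br; lmod R.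
have d'd : d' ** d = (e ^+ 2)%:C *: one by rewrite dE d'E !cmulE rE br; lmod R.
have pd : npos d.
  apply: npos_of_invertible => // t t0.
  apply: (@invertible_factor _ (d' + t%:C *: one)).
    by rewrite !cmulE dd' d'd; lmod R.
  have t2_gt0 : 0 < 2 * t by lra.
  have k0 : 0 < e ^+ 2 + t ^+ 2 by have := exprn_gt0 2 t0; lra.
  (* (d + t) (d' + t) = 2 t r + (e^2 + t^2) *)
  have := npos_invertible k0 (nposZ (ltW t2_gt0) pr).
  congr invertible; rewrite !cmulE dd' dE d'E.
  by lmod R.
have id : invertible d.
  exists (((e ^+ 2)^-1)%:C *: d'); rewrite !cmulE dd' d'd scalerA -rmorphM /=.
  by rewrite mulVf ?gt_eqF // scale1r.
have [t t0 pdt] := npos_invertible_sub pd id.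
have [s [ss sE _ _ sC]] := npos_sqrt t0 pdt; rewrite subrK in sE.
have sb_comm : b ** s = s ** b by apply: sC; rewrite dE !cmulE br.
have [w wE] : exists w, w = s ** c by eexists.
have wwE : w ** star w = (2^-1)%:C *: ((e ^+ 2)%:C *: one - d ** d).
  have -> : w ** star w = b ** d.
    by rewrite wE starM ss cmulA -(cmulA s) -bE -sb_comm -cmulA sE.
  by rewrite -dd' dE d'E !cmulE br; lmod R.
have pww : npos (star w ** w + (e ^+ 2 / 2)%:C *: one).
  have -> : star w ** w + (e ^+ 2 / 2)%:C *: one =
      (w ** star w + star w ** w) + (2^-1)%:C *: (d ** d).
    by rewrite wwE rmorphM /=; lmod R.
  apply: nposD; first exact: npos_add_conj_sqr.
  by apply: nposZ; [rewrite invr_ge0 | exact: npos_sqr].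
have : npos (w ** star w + (e ^+ 2 / 2)%:C *: one).
  apply: npos_of_invertible => [|t' t'0]; first by rewrite !starE starK.
  rewrite -addrA -scalerDl -rmorphD /=; apply: invertible_swap.
    by rewrite gt_eqF //; lra.
  by rewrite rmorphD /= scalerDl addrA; apply: npos_invertible.
move=> /(nposZ (ler0n _ 2)) pdd.
have d_le : nrm d ^+ 2 <= 2 * e ^+ 2.
  apply: nrm_le_of_sqr => //; first lra.
  move: pdd; congr npos; rewrite wwE !rmorphM /=; lmod R.
exists r => //; rewrite -dE; have := nrm_ge0 d.
have -> : e' = 2 * e by rewrite /e; lra.
nra.
Qed.

(** If s^2 = p + e then c p c^* is close to the positive element
    (c s) (c s)^*. *)
Lemma npos_conj p c : npos p -> npos (c ** p ** star c).
Proof.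
move=> pp; apply: npos_closed => [|e e0].
  by rewrite !starM starK npos_sa // cmulA.
have k0 : 0 < nrm (c ** star c) + 1 by have := nrm_ge0 (c ** star c); lra.
have d0 : 0 < e / (nrm (c ** star c) + 1) by rewrite divr_gt0.
have [s [ss sE _ _ _]] := npos_sqrt d0 pp.
exists ((c ** s) ** star (c ** s)); first exact: npos_mul_star.
rewrite starM ss cmulA -(cmulA c) sE.
have -> : c ** (p + (e / (nrm (c ** star c) + 1))%:C *: one) ** star c -
  c ** p ** star c = (e / (nrm (c ** star c) + 1))%:C *: (c ** star c).
  by rewrite !cmulE; lmod R.
rewrite (nrmZp _ (ltW d0)) mulrAC ler_pdivrMr //; nra.
Qed.

End Positive.

(** * Hilbert modules and adjointable maps *)

Section Hilbert.
Context {R : realType} {A : unitalCstarAlgType R} {H : hilbertModType A}.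
Implicit Types (x y z : H) (a b : A) (k : R[i]) (T : H -> H).
Local Notation one := (@cone R A).

Lemma scale_act k x : k *: x = act (k *: one) x.
Proof. by rewrite actZ act1. Qed.

Lemma innerZk k x y : inner (k *: x) y = k *: inner x y.
Proof. by rewrite scale_act innerZ cmulZl cmul1l. Qed.
Lemma innerNl x y : inner (- x) y = - inner x y.
Proof. by rewrite -scaleN1r innerZk scaleN1r. Qed.
Lemma innerBl x y z : inner (x - y) z = inner x z - inner y z.
Proof. by rewrite innerD innerNl. Qed.
Lemma inner0l y : inner 0 y = 0.
Proof. by rewrite -(subrr y) innerBl subrr. Qed.
Lemma innerDr x y z : inner x (y + z) = inner x y + inner x z.
Proof. by rewrite inner_star innerD starD -!inner_star. Qed.
Lemma innerNr x y : inner x (- y) = - inner x y.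
Proof. by rewrite inner_star innerNl starN -inner_star. Qed.
Lemma innerBr x y z : inner x (y - z) = inner x y - inner x z.
Proof. by rewrite innerDr innerNr. Qed.
Lemma innerZr a x y : inner x (act a y) = inner x y ** star a.
Proof. by rewrite inner_star innerZ starM -inner_star. Qed.
Lemma inner_suml (I : Type) (r : seq I) (F : I -> H) y :
  inner (\sum_(i <- r) F i) y = \sum_(i <- r) inner (F i) y.
Proof.
elim: r => [|i r IH]; first by rewrite !big_nil inner0l.
by rewrite !big_cons innerD IH.
Qed.

Lemma inner_npos x : npos (inner x x).
Proof. exact: cstar_pos_npos (inner_pos x). Qed.

Lemma nrm_inner x : nrm (inner x x) = nrm x ^+ 2.
Proof.
apply: complexI; rewrite rmorphXn /= -!normE.
by rewrite [in RHS]hilbert_norm sqrtCK.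
Qed.

Lemma inner_nondegenerate x y : (forall z, inner x z = inner y z) -> x = y.
Proof.
move=> h; apply/eqP; rewrite -subr_eq0; apply/eqP/nrm_eq0/eqP.
by rewrite -sqrf_eq0 -nrm_inner innerBl h subrr nrm0.
Qed.

(** With X := <x, y> and t := norm(y)^-2, the positivity of <z, z> for
    z := x - t X y gives t X X^* <= <x, x>; take norms. *)
Lemma cauchy_schwarz x y : nrm (inner x y) <= nrm x * nrm y.
Proof.
have [y0|y0] := eqVneq (nrm y) 0.
  by rewrite (nrm_eq0 y0) inner_star inner0l star0 !nrm0 mulr0.
have ny : 0 < nrm y by rewrite lt_def y0 nrm_ge0.
pose t := (nrm y ^+ 2)^-1; have t0 : 0 < t by rewrite invr_gt0 exprn_gt0.
have [X XE] : exists X, X = inner x y by eexists.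
have XsE : inner y x = star X by rewrite XE -inner_star.
pose z := x - act (t%:C *: X) y.
have zz : npos (inner x x - t%:C *: (X ** star X)).
  have -> : inner x x - t%:C *: (X ** star X) = inner z z +
      (t * t)%:C *: (X ** ((nrm y ^+ 2)%:C *: one - inner y y) ** star X).
    rewrite /z !(innerBl, innerBr, innerZ, innerZr) -XE XsE !starE !cmulE.
    have tn : t * nrm y ^+ 2 = 1 by rewrite /t mulVf // sqrf_eq0.
    have -> : (t * t)%:C *:
        ((nrm y ^+ 2)%:C *: (X ** star X) - X ** inner y y ** star X) =
      t%:C *: (X ** star X) - (t * t)%:C *: (X ** inner y y ** star X).
      rewrite scalerBr scalerA -rmorphM /=; congr (_%:C *: _ - _).
      by rewrite -mulrA tn mulr1.
    by lmod R.
  apply: nposD; first exact: inner_npos.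
  apply: nposZ; first by rewrite mulr_ge0 // ltW.
  apply/npos_conj/npos_real_sub; first by rewrite -inner_star.
  by rewrite nrm_inner.
have := nrm_mono (nposZ (ltW t0) (npos_mul_star X)) zz.
rewrite (nrmZp _ (ltW t0)) -{1}(starK X) nrm_starM nrm_star nrm_inner -XE.
rewrite /t mulrC ler_pdivrMr ?exprn_gt0 // -exprMn => h.
by rewrite -(@ler_pXn2r _ 2) // nnegrE ?mulr_ge0 ?nrm_ge0.
Qed.

Lemma nrm_act a x : nrm (act a x) <= nrm a * nrm x.
Proof.
rewrite -(@ler_pXn2r _ 2) // ?nnegrE ?mulr_ge0 ?nrm_ge0 //.
rewrite -nrm_inner innerZ innerZr.
apply: le_trans (nrmM _ _) _; apply: le_trans (ler_wpM2l (nrm_ge0 _) (nrmM _ _)) _.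
by rewrite nrm_star nrm_inner exprMn le_eqVlt; apply/orP; left; apply/eqP; ring.
Qed.

Lemma adjointableD T x y : adjointable T -> T (x + y) = T x + T y.
Proof.
move=> [T' TT']; apply: inner_nondegenerate => z.
by rewrite innerD !TT' innerD.
Qed.

Lemma adjointable_act T a x : adjointable T -> T (act a x) = act a (T x).
Proof.
move=> [T' TT']; apply: inner_nondegenerate => z.
by rewrite innerZ !TT' innerZ.
Qed.

Lemma adjointableZ T k x : adjointable T -> T (k *: x) = k *: T x.
Proof. by move=> aT; rewrite !scale_act adjointable_act. Qed.

Lemma adjointableB T x y : adjointable T -> T (x - y) = T x - T y.
Proof.
by move=> aT; rewrite adjointableD // -scaleN1r adjointableZ // scaleN1r.
Qed.

Lemma adjointable0 T : adjointable T -> T 0 = 0.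
Proof. by move=> aT; rewrite -[in LHS](subrr (0 : H)) adjointableB // subrr. Qed.

Lemma adjointable_sum T (I : Type) (r : seq I) (F : I -> H) : adjointable T ->
  T (\sum_(i <- r) F i) = \sum_(i <- r) T (F i).
Proof.
move=> aT; elim: r => [|i r IH]; last by rewrite !big_cons adjointableD // IH.
by rewrite !big_nil adjointable0.
Qed.

(** The maps x |-> <T x, y> = <x, T^* y>, for norm y <= 1, are bounded, and at
    each x they are bounded by norm (T x) uniformly in y. By the uniform
    boundedness principle they have a common bound on the unit ball; at x it is
    a bound for T x itself, as y = T x / norm (T x) shows. *)
Lemma adjointable_bounded T : adjointable T ->
  exists2 M : R, 0 <= M & forall x, nrm (T x) <= M * nrm x.
Proof.
move=> aT; have [T' TT'] := aT.
pose V := realified H; pose W := realified A.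
pose F : set (V -> W) :=
  [set f | exists2 y : H, nrm y <= 1 & f = (fun x => inner (T x) y)].
have F_lin f : F f -> bounded_fun_norm f /\ linear f.
  move=> [y _ ->]; split.
    move=> r; exists (`|r| * nrm (T' y)) => x x_le.
    rewrite -[X in X <= _]/(nrm (inner (T x) y)) TT'.
    apply: le_trans (cauchy_schwarz _ _) _.
    by rewrite ler_wpM2r ?nrm_ge0 //; apply: le_trans x_le (ler_norm _).
  move=> k u v; rewrite -[k *: u]/(k%:C *: (u : H)).
  by rewrite [T _](adjointableD _ _ aT) (adjointableZ _ _ aT) innerD innerZk.
have F_bd : pointwise_bounded F.
  move=> x; exists (nrm (T x)) => f [y y1 ->].
  apply: le_trans (cauchy_schwarz (T x) y) _.
  by rewrite ler_piMr ?nrm_ge0.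
have [M hM] := Banach_Steinhauss F_lin F_bd 1.
have unit_sphere x : nrm x != 0 -> nrm (((nrm x)^-1)%:C *: x) = 1.
  by move=> x0; rewrite nrmZp ?invr_ge0 ?nrm_ge0 // mulVf.
exists `|M| => // x.
have [Tx0|Tx0] := eqVneq (nrm (T x)) 0.
  by rewrite Tx0 mulr_ge0 ?nrm_ge0.
have x0 : nrm x != 0.
  apply: contraNneq Tx0 => /nrm_eq0 ->.
  by rewrite adjointable0 // nrm0.
have nx : 0 < nrm x by rewrite lt_def x0 nrm_ge0.
pose y := ((nrm (T x))^-1)%:C *: T x.
have Fy : F (fun x => inner (T x) y).
  by exists y => //; rewrite unit_sphere.
have := hM _ Fy (((nrm x)^-1)%:C *: x); rewrite -[X in X <= 1 -> _]/(nrm _).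
rewrite unit_sphere // => /(_ (lexx _)); rewrite -[X in X <= _]/(nrm _).
rewrite adjointableZ // innerZk nrmZp ?invr_ge0 ?nrm_ge0 //.
rewrite /y inner_star innerZk nrm_star nrmZp ?invr_ge0 ?nrm_ge0 //.
rewrite nrm_inner expr2 mulKf // mulrC ler_pdivrMr // => h.
by apply: le_trans h _; rewrite ler_pM2r // ler_norm.
Qed.

End Hilbert.

(** * Parseval frames *)

Section Frames.
Context {R : realType} {A : unitalCstarAlgType R} {H : hilbertModType A}.
Implicit Types (x y z eta : H) (a b : A) (T : H -> H) (g : nat -> H).
Local Notation one := (@cone R A).

Definition positive_op T : Prop :=
  (forall x y, inner (T x) y = inner x (T y) :> A) /\
  (forall x, npos (inner (T x) x : A)).

Lemma positive_op_adjointable T : positive_op T -> adjointable T.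
Proof. by case=> sT _; exists T. Qed.

Definition deflate T (u : H) : H -> H := fun x => T x - act (inner x u : A) u.

Lemma inner_deflate T u x y :
  inner (deflate T u x) y = inner (T x) y - inner x u ** inner u y :> A.
Proof. by rewrite innerBl innerZ. Qed.

(** One step of the regularised Gram-Schmidt process. With q := <T eta, eta>,
    s := (q + e)^-1, X := <x, T eta> and z := x - X s eta, completing the square
    gives <T' x, x> = <T z, z> + e (X s) (X s)^* for the new operator T', and
    <T' eta, eta> = q - q s q = e (1 - e s) <= e. *)
Lemma gram_schmidt_step T eta (e : R) : positive_op T -> 0 < e ->
  exists u, positive_op (deflate T u) /\
    nrm (inner (deflate T u eta) eta : A) <= e.
Proof.
move=> pT e0; have aT := positive_op_adjointable pT; have [sT pT'] := pT.
have [q qE] : exists q : A, q = inner (T eta) eta by eexists.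
have pq : npos q by rewrite qE.
have [r [sr rE [w [rw wr]] _ _]] := npos_sqrt e0 pq.
have sw : star w = w.
  have swr : star w ** r = one by rewrite -[in LHS]sr -starM rw star1.
  by rewrite -[LHS]cmul1r -rw cmulA swr cmul1l.
have [s sE] : exists s, s = w ** w by eexists.
have ss : star s = s by rewrite sE starM sw.
have qs : q ** s = one - e%:C *: s.
  have : (q + e%:C *: one) ** s = one.
    by rewrite -rE sE cmulA -(cmulA r) rw cmul1r rw.
  by rewrite !cmulE => <-; lmod R.
have sq : s ** q = one - e%:C *: s.
  by have := congr1 star qs; rewrite !starE ss (npos_sa pq).
pose u := act w (T eta).
have innerTu x : inner x u = inner x (T eta) ** w by rewrite innerZr sw.
have inneruT x : inner u x = w ** inner (T eta) x by rewrite innerZ.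
have pos x : npos (inner (deflate T u x) x).
  have [X XE] : exists X : A, X = inner x (T eta) by eexists.
  have XE' : inner (T x) eta = X by rewrite XE sT.
  have XsE : inner (T eta) x = star X by rewrite XE -inner_star.
  pose z := x - act (X ** s) eta.
  have -> : inner (deflate T u x) x =
      inner (T z) z + e%:C *: ((X ** s) ** star (X ** s)).
    rewrite inner_deflate innerTu inneruT -XE XsE /z adjointableB // adjointable_act //.
    rewrite !(innerBl, innerBr, innerZ, innerZr) XE' XsE -qE !starE ss !cmulE.
    rewrite -(cmulA X s q) -(cmulA X (s ** q)) -(cmulA s q) qs.
    by rewrite -(cmulA X w w) -sE !cmulE; lmod R.
  apply: nposD; first exact: pT'.
  by apply: nposZ; [exact: ltW | exact: npos_mul_star].
exists u; split; first split=> // x y.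
  by rewrite inner_deflate innerBr innerZr sT -inner_star.
apply: npos_le_nrm => //; first exact: ltW.
have -> : inner (deflate T u eta) eta = e%:C *: (one - e%:C *: s).
  rewrite inner_deflate innerTu inneruT -sT -qE.
  by rewrite cmulA -(cmulA q) -sE qs !cmulE sq; lmod R.
have -> : e%:C *: one - e%:C *: (one - e%:C *: s) = (e * e)%:C *: (w ** star w).
  by rewrite sw -sE; lmod R.
by apply: nposZ; [rewrite mulr_ge0 // ltW | exact: npos_mul_star].
Qed.

(** The error of the n-th partial sum of the frame expansion of x. *)
Definition residual g n x : H := x - \sum_(0 <= i < n) act (inner x (g i) : A) (g i).

Lemma residualS g n : residual g n.+1 = deflate (residual g n) (g n).
Proof.
by apply/funext => x; rewrite /deflate /residual big_nat_recr //= opprD addrA.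
Qed.

Lemma residual0 g x : residual g 0 x = x.
Proof. by rewrite /residual big_nil subr0. Qed.

Lemma exists_residuals (eta : nat -> H) (e : nat -> R) : (forall n, 0 < e n) ->
  exists g, (forall n, positive_op (residual g n)) /\
    forall n, nrm (inner (residual g n.+1 (eta n)) (eta n) : A) <= e n.
Proof.
move=> e0.
(* The choice is made for every map, positive or not, so that the recursion
   below need not carry a proof of positivity. *)
have /choice[pick pickP] : forall Tn : (H -> H) * nat, exists u, positive_op Tn.1 ->
    positive_op (deflate Tn.1 u) /\
    nrm (inner (deflate Tn.1 u (eta Tn.2)) (eta Tn.2) : A) <= e Tn.2.
  move=> [T n] /=; have [pT|npT] := pselect (positive_op T).
    by have [u hu] := gram_schmidt_step (eta n) pT (e0 n); exists u.
  by exists 0 => /npT.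
pose fix T n : H -> H :=
  if n is m.+1 then deflate (T m) (pick (T m, m)) else id.
pose g n := pick (T n, n).
have resT n : residual g n = T n.
  elim: n => [|n IH]; first by apply/funext => x; rewrite residual0.
  by rewrite residualS IH.
have pT n : positive_op (T n).
  elim: n => [|n IH] /=; last exact: (pickP (T n, n) IH).1.
  by split=> [//|x]; exact: inner_npos.
exists g; split=> n; first by rewrite resT.
by rewrite residualS resT; exact: (pickP (T n, n) (pT n)).2.
Qed.

Lemma inner_residual g n x : inner (residual g n x) x =
  inner x x - \sum_(0 <= i < n) inner x (g i) ** star (inner x (g i)) :> A.
Proof.
rewrite innerBl inner_suml; congr (_ - _); apply: eq_bigr => i _.
by rewrite innerZ -inner_star.
Qed.

Section ResidualTheory.
Context (g : nat -> H).
Context (res_pos : forall n, positive_op (residual g n)).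
Local Notation res := (residual g).

Lemma bessel m n x : (m <= n)%N ->
  npos (inner x x - \sum_(m <= i < n) inner x (g i) ** star (inner x (g i)) : A).
Proof.
move=> mn; have := (res_pos n).2 x.
rewrite inner_residual (big_cat_nat (leq0n m) mn) /=.
set S := \sum_(0 <= i < m) _; set S' := \sum_(m <= i < n) _ => h.
rewrite (_ : _ - _ = (inner x x - (S + S')) + S).
  by apply: nposD => //; apply: npos_sum => i; exact: npos_mul_star.
by lmod R.
Qed.

Lemma inner_res_mono m n x : (m <= n)%N ->
  nrm (inner (res n x) x : A) <= nrm (inner (res m x) x : A).
Proof.
move=> mn; apply: nrm_mono; first exact: (res_pos n).2.
rewrite !inner_residual (big_cat_nat (leq0n m) mn) /=.
set S := \sum_(0 <= i < m) _; set S' := \sum_(m <= i < n) _.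
rewrite (_ : _ - _ - _ = S'); last by lmod R.
by apply: npos_sum => i; exact: npos_mul_star.
Qed.

(** T^2 <= T because 0 <= T <= 1: the difference T - T^2 is
    T (1 - T) T + (1 - T) T (1 - T). *)
Lemma nrm_residual_sqr n x : nrm (res n x) ^+ 2 <= nrm (inner (res n x) x : A).
Proof.
rewrite -nrm_inner; apply: nrm_mono; first exact: inner_npos.
have [sT pT] := res_pos n; have aT := positive_op_adjointable (res_pos n).
have pC z : npos (inner (z - res n z) z : A).
  rewrite innerBl inner_residual opprB addrCA subrr addr0.
  by apply: npos_sum => i; exact: npos_mul_star.
move: (res n) sT pT aT pC => T sT pT aT pC.
have -> : inner (T x) x - inner (T x) (T x) =
    inner (T x - T (T x)) (T x) + inner (T (x - T x)) (x - T x).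
  rewrite adjointableB // !(innerBl, innerBr) -!sT; lmod R.
by apply: nposD.
Qed.

Lemma nrm_residual n x : nrm (res n x) <= nrm x.
Proof.
rewrite -(@ler_pXn2r _ 2) ?nnegrE ?nrm_ge0 // (le_trans (nrm_residual_sqr n x)) //.
by have := inner_res_mono x (leq0n n); rewrite residual0 nrm_inner.
Qed.

(** The residuals are A-linear contractions, so the set of x on which they tend
    to 0 is a closed submodule. On generators the bound for a single n suffices,
    since norm <T_n s, s> decreases with n. *)
Lemma residual_cvg0_generator (S : set H) :
  (forall s (e : R), S s -> 0 < e ->
     exists n, nrm (inner (res n s) s : A) <= e) ->
  dense (linspan S) -> forall x, res n x @[n --> \oo] --> (0 : H).
Proof.
move=> hS dS.
pose C x := forall e, 0 < e -> exists N, forall n, (N <= n)%N -> nrm (res n x) < e.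
have aR n : adjointable (res n) by exact: positive_op_adjointable.
have CS s : S s -> C s.
  move=> Ss e e0; have e2 : 0 < e ^+ 2 / 2 by rewrite divr_gt0 // exprn_gt0.
  have [N hN] := hS s _ Ss e2; exists N => n Nn.
  rewrite -(@ltr_pXn2r _ 2) ?nnegrE ?nrm_ge0 ?(ltW e0) //.
  apply: le_lt_trans (nrm_residual_sqr n s) _.
  by apply: le_lt_trans (le_trans (inner_res_mono s Nn) hN) _; lra.
have CD x y : C x -> C y -> C (x + y).
  move=> Cx Cy e e0; have e2 : 0 < e / 2 by lra.
  have [N hN] := Cx _ e2; have [M hM] := Cy _ e2.
  exists (maxn N M) => n; rewrite geq_max => /andP[Nn Mn].
  rewrite (adjointableD _ _ (aR n)).
  by have := nrmD (res n x) (res n y); have := hN n Nn; have := hM n Mn; lra.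
have Cact a x : C x -> C (act a x).
  move=> Cx e e0; have a0 := nrm_ge0 a.
  have a1 : 0 < nrm a + 1 by lra.
  have [N hN] := Cx _ (divr_gt0 e0 a1); exists N => n Nn.
  have := hN n Nn; rewrite ltr_pdivlMr // (adjointable_act _ _ (aR n)) => h.
  by have := nrm_act a (res n x); have := nrm_ge0 (res n x); nra.
have Cspan x : linspan S x -> C x.
  move=> [m [s [k [a [Ss ->]]]]]; apply: big_ind => //.
    by move=> e e0; exists 0%N => n _; rewrite adjointable0 // nrm0.
  by move=> i _; apply: CD; rewrite ?scale_act; apply: Cact; exact: CS.
move=> x; apply/cvg_nrmP => e e0; have e2 : 0 < e / 2 by lra.
have ec : 0 < (e / 2)%:C by rewrite ltcR.
have [|y [/= xy Sy]] := dS (ball x (e / 2)%:C) _ (@ball_open _ _ x _).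
  by exists x; exact: ballxx.
have [N hN] := Cspan y Sy _ e2; exists N => n Nn.
have {}xy : nrm (x - y) < e / 2 by move: xy; rewrite -ball_normE /= normE ltcR.
rewrite subr0 -(subrK y x) (adjointableD _ _ (aR n)).
have := nrmD (res n (x - y)) (res n y); have := nrm_residual n (x - y).
by have := hN n Nn; lra.
Qed.

(** For y the sum of the c_i g_i and a_i := <y, g_i>, the sum of the
    c_i a_i^* is <y, y>. So the positive element sum (c_i - a_i) (c_i - a_i)^* is
    sum c_i c_i^* - 2 <y, y> + sum a_i a_i^*, where the last sum is at most
    <y, y> by Bessel's inequality; therefore <y, y> is at most the sum of the
    c_i c_i^*. *)
Lemma bessel_synthesis (c : nat -> A) m n : (m <= n)%N ->
  nrm (\sum_(m <= i < n) act (c i) (g i)) ^+ 2 <=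
  nrm (\sum_(m <= i < n) c i ** star (c i)).
Proof.
move=> mn; set y := \sum_(m <= i < n) _; set C := \sum_(m <= i < n) _.
rewrite -nrm_inner; apply: nrm_mono; first exact: inner_npos.
pose a i : A := inner y (g i).
have yy : inner y y = \sum_(m <= i < n) c i ** star (a i).
  by rewrite [LHS]inner_suml; apply: eq_bigr => i _; rewrite innerZ -inner_star.
have yy' : inner y y = \sum_(m <= i < n) a i ** star (c i).
  rewrite inner_star yy; elim/big_ind2: _ => [|u u' v v' <- <-|i _].
  - exact: star0.
  - exact: starD.
  - by rewrite starM starK.
have -> : C - inner y y = \sum_(m <= i < n) (c i - a i) ** star (c i - a i) +
    (inner y y - \sum_(m <= i < n) a i ** star (a i)).
  have -> : \sum_(m <= i < n) (c i - a i) ** star (c i - a i) =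
      C - inner y y - (inner y y - \sum_(m <= i < n) a i ** star (a i)).
    rewrite {1}yy yy' -!sumrB; apply: eq_bigr => i _.
    by rewrite !starE !cmulE; lmod R.
  by rewrite subrK.
apply: nposD; last exact: bessel.
by apply: npos_sum => i; exact: npos_mul_star.
Qed.

End ResidualTheory.

(** Each natural number codes a pair (i, k): at this step the vector is the i-th
    generator and the tolerance is 1/(k+1). *)
Theorem exists_parseval_frame : countably_generated H ->
  exists g, (forall n, positive_op (residual g n)) /\
    forall x, residual g n x @[n --> \oo] --> (0 : H).
Proof.
move=> [S [cS dS]].
have [eta etaS] : exists eta : nat -> H, forall s, S s -> exists n, eta n = s.
  have /countable_injP[f finj] := cS.
  exists (fun n => xget 0 [set s | S s /\ f s = n]) => s Ss; exists (f s).
  case: xgetP => [s' _ [Ss' fs']|/(_ s)[]//].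
  by apply: finj => //; rewrite inE.
pose code n : nat * nat := odflt (0%N, 0%N) (unpickle n).
have e0 n : 0 < ((code n).2.+1%:R^-1 : R) by rewrite invr_gt0 ltr0n.
have [g [pg hg]] := exists_residuals (fun n => eta (code n).1) e0.
exists g; split=> //; apply: (residual_cvg0_generator pg _ dS) => s e Ss e_gt0.
have [i <-] := etaS s Ss.
pose k := Num.truncn (e^-1).
exists (pickle (i, k)).+1; have := hg (pickle (i, k)).
rewrite /code pickleK /= => h; apply: le_trans h _.
rewrite invf_ple ?posrE ?ltr0n //; apply: ltW; exact: truncnS_gt.
Qed.

End Frames.

(** * Atomic systems *)

Lemma partial_sumT (V : nmodType) (u : nat -> V) :
  partial_sum setT u = fun n => \sum_(0 <= j < n) u j.
Proof. by apply/funext => n; apply: eq_bigl => j; rewrite in_setT. Qed.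

Lemma finitely_countably_generated (R : realType) (A : unitalCstarAlgType R)
    (H : hilbertModType A) : finitely_generated H -> countably_generated H.
Proof.
move=> [S [fS spanS]].
exists S; split; first exact: finite_set_countable.
by rewrite spanS => O O0 _; rewrite setIT.
Qed.

Lemma cstar_pos0 (R : realType) (A : unitalCstarAlgType R) : cstar_pos (0 : A).
Proof.
split=> [|z]; first exact: star0.
have [->//|z0] := eqVneq z 0; case.
exists (z^-1 *: cone).
by rewrite subr0 !cmulE !scalerA mulfV // mulVf // scale1r.
Qed.

Theorem theorem2p4 (R : realType) (A : unitalCstarAlgType R)
    (H : hilbertModType A) (K : H -> H) :
  finitely_generated H \/ countably_generated H ->
  adjointable K ->
  exists (J : set nat) (f : nat -> H), atomic_system J f K.
Proof.
move=> gen aK.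
have {}gen : countably_generated H.
  by case: gen => //; exact: finitely_countably_generated.
have [g [pg cg]] := exists_parseval_frame gen.
have [M M0 KM] := adjointable_bounded aK.
exists setT, (fun n => K (g n)); split.
  move=> c; rewrite /ell2 !partial_sumT => /cvgn_nrmP cc; apply/cvgn_nrmP => e e0.
  have M1 : 0 < M + 1 by lra.
  have d0 : 0 < e / (M + 1) by rewrite divr_gt0.
  have [N hN] := cc _ (exprn_gt0 2 d0); exists N => m n Nm mn.
  have := hN m n Nm mn; rewrite !(big_cat_nat (leq0n m) mn) /=.
  rewrite !(addrC (\sum_(0 <= i < m) _)) !addrK.
  have -> : \sum_(m <= i < n) act (c i) (K (g i)) =
      K (\sum_(m <= i < n) act (c i) (g i)).
    by rewrite adjointable_sum //; apply: eq_bigr => i _; rewrite adjointable_act.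
  have := bessel_synthesis pg c mn; move: (\sum_(m <= i < n) act _ _) => y yc cd.
  have : nrm y < e / (M + 1).
    rewrite -(@ltr_pXn2r _ 2) ?nnegrE ?nrm_ge0 ?(ltW d0) //.
    exact: le_lt_trans yc cd.
  by rewrite ltr_pdivlMr // => ye; have := KM y; have := nrm_ge0 y; nra.
exists 1; split=> // x; exists (fun n => inner x (g n)).
have /cvg_nrmP cx := cg x.
have parseval : partial_sum setT (fun n => inner x (g n) ** star (inner x (g n)))
    @ \oo --> (inner x x : A).
  rewrite partial_sumT; apply/cvg_nrmP => e e0.
  have x0 := nrm_ge0 x; have x1 : 0 < nrm x + 1 by lra.
  have [N hN] := cx _ (divr_gt0 e0 x1); exists N => n /hN.
  rewrite subr0 ltr_pdivlMr // nrm_distC -inner_residual => h.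
  by have := cauchy_schwarz (residual g n x) x; have := nrm_ge0 (residual g n x); nra.
split.
- by apply/cvg_ex; exists (inner x x).
- rewrite (cvg_lim _ parseval) // rmorph1 scale1r /cstar_le subrr.
  exact: cstar_pos0.
- rewrite partial_sumT; apply/cvg_nrmP => e e0.
  have M1 : 0 < M + 1 by lra.
  have [N hN] := cx _ (divr_gt0 e0 M1); exists N => n /hN.
  rewrite subr0 ltr_pdivlMr // nrm_distC.
  have -> : K x - \sum_(0 <= j < n) act (inner x (g j)) (K (g j)) = K (residual g n x).
    rewrite (adjointableB _ _ aK) (adjointable_sum _ _ aK); congr (_ - _).
    by apply: eq_bigr => i _; rewrite adjointable_act.
  by have := KM (residual g n x); have := nrm_ge0 (residual g n x); nra.
Qed.
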